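(* Every $2$-local $\frac12$-derivation of the complex Lie algebra $\mathfrak{L}^2$ is a $\frac12$-derivation.
   Context: All algebras are over $\mathbb{C}$. A linear map $D:\mathfrak{L}\to\mathfrak{L}$ on a Lie algebra is a $\frac12$-derivation if $D[x,y]=\frac12\big([D(x),y]+[x,D(y)]\big)$ for all $x,y\in\mathfrak{L}$. A map $\nabla:\mathfrak{L}\to\mathfrak{L}$ (not necessarily linear) is a $2$-local $\frac12$-derivation if for all $x,y\in\mathfrak{L}$ there is a $\frac12$-derivation $D_{x,y}$ with $\nabla(x)=D_{x,y}(x)$ and $\nabla(y)=D_{x,y}(y)$. $\mathfrak{L}^2=\mathfrak{sl}_2\ltimes\mathfrak{r}$ is the $6$-dimensional Lie algebra with basis $\{e,f,h,x_0,x_1,x_2\}$, where $\mathfrak{r}=\operatorname{span}\{x_0,x_1,x_2\}$ is an abelian ideal which is the $3$-dimensional irreducible $\mathfrak{sl}_2$-module, and brackets $[e,f]=h$, $[h,e]=2e$, $[f,h]=2f$, $[x_k,h]=(2k-2)x_k$ for $0\le k\le 2$, $[x_k,f]=x_{k+1}$ for $0\le k\le 1$, $[x_k,e]=k(3-k)x_{k-1}$ for $1\le k\le 2$; brackets of basis elements not obtained from these by antisymmetry are zero. *)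

(* Defs.v *)
From HB Require Import structures.
From mathcomp Require Import all_boot all_order all_algebra.
From mathcomp Require Import reals.
From mathcomp Require Export complex.
From mathcomp Require Import ring.

Set Implicit Arguments.
Unset Strict Implicit.
Unset Printing Implicit Defensive.

Import GRing.Theory.
Local Open Scope ring_scope.

HB.mixin Record Lmodule_isLie (K : fieldType) V of GRing.Lmodule K V := {
  lie : V -> V -> V;
  lie_linearl : forall (a : K) (x y z : V),
    lie (a *: x + y) z = a *: lie x z + lie y z;
  lie_linearr : forall (a : K) (x y z : V),
    lie x (a *: y + z) = a *: lie x y + lie x z;
  liexx : forall x : V, lie x x = 0;
  lie_jacobi : forall x y z : V,
    lie x (lie y z) + lie y (lie z x) + lie z (lie x y) = 0
}.

#[short(type="lieAlgType")]
HB.structure Definition LieAlgebra (K : fieldType) :=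
  {V of Lmodule_isLie K V & GRing.Lmodule K V}.

(* Meaningful only when 2 is invertible in K, as 0^-1 = 0. *)
Definition half_derivation (K : fieldType) (L : lieAlgType K) (D : L -> L) :=
  linear D /\
  forall x y : L, D (lie x y) = 2^-1 *: (lie (D x) y + lie x (D y)).

Definition two_local_half_derivation (K : fieldType) (L : lieAlgType K)
    (nabla : L -> L) :=
  forall x y : L, exists D : L -> L,
    [/\ half_derivation D, nabla x = D x & nabla y = D y].

Section L2.
Variable K : fieldType.

(* Coordinates in the ordered basis e, f, h, x_0, x_1, x_2; thus x_k has
   index k + 3. *)
Definition L2 := 'rV[K]_6.
Local Notation V := 'rV[K]_6.

Definition L2_basis (i : 'I_6) : V := delta_mx 0 i.

Definition L2_e : V := L2_basis (inord 0).
Definition L2_f : V := L2_basis (inord 1).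
Definition L2_h : V := L2_basis (inord 2).
Definition L2_x (k : nat) : V := L2_basis (inord k.+3).

(* The listed brackets only, with 0 everywhere else; antisymmetrized below. *)
Definition L2_table (i j : nat) : V :=
  match i, j with
  | 0, 1 => L2_h
  | 2, 0 => 2 *: L2_e
  | 1, 2 => 2 *: L2_f
  | k.+3, 2 => if (k <= 2)%N then ((2 * k)%:R - 2) *: L2_x k else 0
  | k.+3, 1 => if (k <= 1)%N then L2_x k.+1 else 0
  | k.+3, 0 => if (1 <= k <= 2)%N then (k * (3 - k))%:R *: L2_x k.-1 else 0
  | _, _ => 0
  end.

Definition L2_bracket (u v : V) : V :=
  \sum_(i < 6) \sum_(j < 6) (u 0 i * v 0 j) *: (L2_table i j - L2_table j i).

Lemma L2_bracket_basis (i j : 'I_6) :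
  L2_bracket (L2_basis i) (L2_basis j) = L2_table i j - L2_table j i.
Proof.
rewrite /L2_bracket (bigD1 i) //= (bigD1 j) //= !mxE !eqxx mul1r scale1r.
rewrite big1 ?addr0 => [|k /negPf kj]; last first.
  by rewrite !mxE kj mulr0 scale0r.
rewrite big1 ?addr0 // => l /negPf li; rewrite big1 // => k _.
by rewrite !mxE li mul0r scale0r.
Qed.

Definition L2_minor (u v : V) (i j : nat) : K :=
  u 0 (inord i) * v 0 (inord j) - u 0 (inord j) * v 0 (inord i).

Lemma L2_bracketE (u v : V) :
  L2_bracket u v =
    (2 * L2_minor u v 2 0) *: L2_e + (2 * L2_minor u v 1 2) *: L2_f
    + L2_minor u v 0 1 *: L2_h
    + (2 * L2_minor u v 4 0 - 2 * L2_minor u v 3 2) *: L2_x 0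
    + (L2_minor u v 3 1 + 2 * L2_minor u v 5 0) *: L2_x 1
    + (L2_minor u v 4 1 + 2 * L2_minor u v 5 2) *: L2_x 2.
Proof.
pose S (F : nat -> V) := F 0%N + F 1%N + F 2%N + F 3%N + F 4%N + F 5%N.
have sum6 (F : nat -> V) : \sum_(i < 6) F i = S F.
  by rewrite !big_ord_recr big_ord0 /= add0r.
pose T (i j : nat) : V :=
  (u 0 (inord i) * v 0 (inord j)) *: (L2_table i j - L2_table j i).
have -> : L2_bracket u v = S (fun i => S (T i)).
  rewrite -sum6; apply: eq_bigr => i _; rewrite -sum6.
  by apply: eq_bigr => j _; rewrite /T !inord_val.
rewrite /S /T /L2_table /=.
rewrite !(subrr, subr0, sub0r, scaler0, addr0, add0r).
apply/rowP => k; rewrite !mxE /L2_minor /=.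
move: (k == inord 0) (k == inord 1) (k == inord 2) => b0 b1 b2.
move: (k == inord 3) (k == inord 4) (k == inord 5) => b3 b4 b5.
have [-> ->] : (1 * (3 - 1) = 2)%N /\ (2 * (3 - 2) = 2)%N by [].
ring.
Qed.

Lemma L2_ext (u v : V) :
  (forall k, (k < 6)%N -> u 0 (inord k) = v 0 (inord k)) -> u = v.
Proof.
by move=> uv; apply/rowP => k; have := uv k (ltn_ord k); rewrite inord_val.
Qed.

Lemma L2_bracket_coord (u v : V) :
  ((L2_bracket u v 0 (inord 0) = (2 * L2_minor u v 2 0)%R) *
  (L2_bracket u v 0 (inord 1) = (2 * L2_minor u v 1 2)%R) *
  (L2_bracket u v 0 (inord 2) = L2_minor u v 0 1) *
  (L2_bracket u v 0 (inord 3) =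
    (2 * L2_minor u v 4 0 - 2 * L2_minor u v 3 2)%R) *
  (L2_bracket u v 0 (inord 4) = (L2_minor u v 3 1 + 2 * L2_minor u v 5 0)%R) *
  (L2_bracket u v 0 (inord 5) = (L2_minor u v 4 1 + 2 * L2_minor u v 5 2)%R))%type.
Proof.
have inordE i j : (i < 6)%N -> (j < 6)%N ->
    (inord i == inord j :> 'I_6) = (i == j).
  by move=> i6 j6; rewrite -val_eqE /= !inordK.
by do !split; rewrite L2_bracketE !mxE !inordE //=; ring.
Qed.

Lemma L2_bracket_linearl (a : K) (x y z : V) :
  L2_bracket (a *: x + y) z = a *: L2_bracket x z + L2_bracket y z.
Proof.
by apply: L2_ext => -[|[|[|[|[|[|//]]]]]] _;
  rewrite [RHS]mxE [X in _ = X + _]mxE !L2_bracket_coord /L2_minor !mxE; ring.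
Qed.

Lemma L2_bracketxx (x : V) : L2_bracket x x = 0.
Proof.
by apply: L2_ext => -[|[|[|[|[|[|//]]]]]] _;
  rewrite [RHS]mxE L2_bracket_coord /L2_minor; ring.
Qed.

Lemma L2_bracket_linearr (a : K) (x y z : V) :
  L2_bracket x (a *: y + z) = a *: L2_bracket x y + L2_bracket x z.
Proof.
by apply: L2_ext => -[|[|[|[|[|[|//]]]]]] _;
  rewrite [RHS]mxE [X in _ = X + _]mxE !L2_bracket_coord /L2_minor !mxE; ring.
Qed.

Lemma L2_jacobi (x y z : V) :
  L2_bracket x (L2_bracket y z) + L2_bracket y (L2_bracket z x)
  + L2_bracket z (L2_bracket x y) = 0.
Proof.
by apply: L2_ext => -[|[|[|[|[|[|//]]]]]] _;
  rewrite [RHS]mxE [LHS]mxE [X in X + _ = _]mxE !L2_bracket_coord /L2_minor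
    !L2_bracket_coord /L2_minor; ring.
Qed.

HB.instance Definition _ := GRing.Lmodule.on L2.
HB.instance Definition _ := Lmodule_isLie.Build K L2
  L2_bracket_linearl L2_bracket_linearr L2_bracketxx L2_jacobi.

End L2.

(* Main.v *)
From HB Require Import structures.
Require Import Defs.
From mathcomp Require Import all_boot all_order all_algebra.
From mathcomp Require Import reals complex.
From mathcomp Require Import ring.

(** A half-derivation of sl_2 |x r is determined by its value at the single
    element e.  Granted this, for a 2-local half-derivation nabla each witness
    for a pair (e, y) takes the value nabla e at e, so all these witnesses are
    one and the same half-derivation D, and nabla y = D y for every y.

    By linearity the rigidity claim says that a half-derivation D with D e = 0
    vanishes, which has two parts.

    On sl_2: put u = D h and v = D f.  Applying D to the three relations of the
    sl_2-triple and eliminating v gives [h, u] = - 4 u, and once u = 0 also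
    [h, v] = - 4 v.  The eigenvalues of ad h on the whole algebra are 2, 0 and
    - 2, so u and v vanish ([half_derivation_sl2_triple_eq0]).

    Everywhere else: once D kills s and t, it intertwines ad s and ad t with
    their halves, hence ad [s, t] with both its half and its quarter, so
    [[s, t], D x] = 0 for all x ([half_derivation_commutator_centralizes]).
    As sl_2 is perfect, D x centralizes sl_2, and neither sl_2 nor its adjoint
    module r contains a nonzero invariant, so D x = 0. *)

Set Implicit Arguments.
Unset Strict Implicit.
Unset Printing Implicit Defensive.

Import GRing.Theory.
Local Open Scope ring_scope.

Section HalfDerivation.
Variables (K : fieldType) (L : lieAlgType K).
Implicit Types (x y z e f h : L) (D : L -> L).

HB.instance Definition _ x :=
  GRing.isLinear.Build K L L *:%R (lie x) (fun a => lie_linearr a x).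

Lemma lieDl x y z : lie (x + y) z = lie x z + lie y z.
Proof. by rewrite -{1}[x]scale1r lie_linearl scale1r. Qed.

Lemma lieC x y : lie x y = - lie y x.
Proof.
apply/eqP; rewrite -addr_eq0; apply/eqP.
by have := liexx (x + y); rewrite lieDl !linearD /= !liexx add0r addr0.
Qed.

Lemma lie0l x : lie 0 x = 0.
Proof. by rewrite lieC linear0 oppr0. Qed.

Lemma lieZl a x y : lie (a *: x) y = a *: lie x y.
Proof. by rewrite lieC linearZ /= -scalerN -lieC. Qed.

Lemma lieBl x y z : lie (x - y) z = lie x z - lie y z.
Proof. by rewrite lieDl -scaleN1r lieZl scaleN1r. Qed.

Lemma lie_leibniz x y z : lie x (lie y z) = lie (lie x y) z + lie y (lie x z).
Proof.
rewrite (lieC (lie x y)) (lieC x z) linearN /= -opprD; apply/eqP.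
by rewrite -addr_eq0 [lie z _ + _]addrC addrA lie_jacobi.
Qed.

Lemma half_derivationB D1 D2 :
  half_derivation D1 -> half_derivation D2 ->
  half_derivation (fun x => D1 x - D2 x).
Proof.
move=> [lin1 der1] [lin2 der2]; split=> [a x y|x y].
  by rewrite lin1 lin2 scalerBr opprD addrACA.
by rewrite der1 der2 lieBl [lie x (_ - _)]linearB /= -scalerBr opprD addrACA.
Qed.

Lemma half_derivationZ D a x : half_derivation D -> D (a *: x) = a *: D x.
Proof. by case=> linD _; exact: (GRing.scalable_linear linD). Qed.

Lemma half_derivationM2 D x y :
  2 != 0 :> K -> half_derivation D ->
  2 *: D (lie x y) = lie (D x) y + lie x (D y).
Proof. by move=> two0 [_ ->]; rewrite scalerA divff ?scale1r. Qed.

Lemma half_derivation_intertwines D s x :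
  half_derivation D -> D s = 0 -> D (lie s x) = 2^-1 *: lie s (D x).
Proof.
by move=> [_ ->] Ds0; rewrite Ds0 lie0l add0r.
Qed.

(** Writing [[s, t], x] as [s, [t, x]] - [t, [s, x]] brings out the factor 1/2
    twice, while [D [s, t] = 0] brings it out once. *)
Lemma half_derivation_commutator_centralizes D s t x :
  2 != 0 :> K -> half_derivation D -> D s = 0 -> D t = 0 ->
  lie (lie s t) (D x) = 0.
Proof.
move=> two0 halfD Ds0 Dt0.
have Dst0 : D (lie s t) = 0.
  by rewrite half_derivation_intertwines // Dt0 linear0 scaler0.
have once := half_derivation_intertwines x halfD Dst0.
have twice : D (lie (lie s t) x) = (2^-1 * 2^-1) *: lie (lie s t) (D x).
  have lie_lie y : lie (lie s t) y = lie s (lie t y) - lie t (lie s y).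
    by rewrite lie_leibniz addrK.
  have [linD _] := halfD.
  rewrite !lie_lie -scaleN1r addrC linD !(half_derivation_intertwines _ halfD) //.
  by rewrite scaleN1r !linearZ /= !scalerA scalerBr addrC scalerN.
move: once; rewrite twice => /(congr1 (GRing.scale (2 * 2))).
rewrite !scalerA mulrACA divff // mul1r -mulrA divff // mulr1 scale1r => eq12.
apply: (@addrI _ (lie (lie s t) (D x))).
by rewrite addr0 {3}eq12 scaler_nat mulr2n.
Qed.

(** With [u = D h] and [v = D f], the three relations become [[e, v] = 2 u],
    [[e, u] = 0] and [[h, v] + [u, f] = - 4 v].  Applying ad e to the last one
    turns [[u, f]] into [- [h, u]], turns [[h, v]] into [2 [h, u] - 4 u], and
    leaves [[h, u] = - 4 u]. *)
Lemma half_derivation_sl2_triple_eq0 D e f h :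
  2 != 0 :> K -> half_derivation D ->
  lie e f = h -> lie h e = 2 *: e -> lie f h = 2 *: f ->
  (forall w, lie h w = - 4 *: w -> w = 0) ->
  D e = 0 -> D h = 0 /\ D f = 0.
Proof.
move=> two0 halfD ef he fh noeig De0.
have ev : lie e (D f) = 2 *: D h.
  by rewrite -ef half_derivationM2 // De0 lie0l add0r.
have eh : lie e h = - 2 *: e by rewrite lieC he scaleNr.
have eu : lie e (D h) = 0.
  have := half_derivationM2 e h two0 halfD.
  by rewrite eh half_derivationZ // De0 !scaler0 lie0l add0r.
have hf : lie h f = - 2 *: f by rewrite lieC fh scaleNr.
have hv : lie (D h) f + lie h (D f) = - 4 *: D f.
  rewrite -half_derivationM2 // hf half_derivationZ // scalerA.
  by congr (_ *: _); ring.
have u0 : D h = 0.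
  apply: noeig; move: (congr1 (lie e) hv).
  rewrite linearD linearZ /= !(lie_leibniz e) eu ef eh ev lie0l add0r.
  rewrite (lieC (D h) h) lieZl linearZ /= ev !scalerA => lin.
  move: lin; rewrite scaler_nat mulr2n addrCA addKr => /(canRL (addKr _)) ->.
  by rewrite -scaleNr -scalerDl; congr (_ *: _); ring.
split=> //; apply: noeig.
by move: hv; rewrite u0 lie0l add0r.
Qed.

End HalfDerivation.

Section L2.
Variable K : fieldType.
Implicit Type w : L2 K.
Local Notation e := (L2_e K : L2 K).
Local Notation f := (L2_f K : L2 K).
Local Notation h := (L2_h K : L2 K).

Lemma L2_lieE (u v : L2 K) : lie u v = L2_bracket u v.
Proof. by []. Qed.

Lemma inord6E i j : (i < 6)%N -> (j < 6)%N ->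
  (inord i == inord j :> 'I_6) = (i == j).
Proof. by move=> i6 j6; rewrite -val_eqE /= !inordK. Qed.

Lemma L2_lie_ef : lie e f = h.
Proof.
by apply: L2_ext => -[|[|[|[|[|[|//]]]]]] _;
  rewrite L2_lieE L2_bracket_coord /L2_minor !mxE !inord6E //=; ring.
Qed.

Lemma L2_lie_he : lie h e = 2 *: e.
Proof.
by apply: L2_ext => -[|[|[|[|[|[|//]]]]]] _;
  rewrite L2_lieE L2_bracket_coord /L2_minor !mxE !inord6E //=; ring.
Qed.

Lemma L2_lie_fh : lie f h = 2 *: f.
Proof.
by apply: L2_ext => -[|[|[|[|[|[|//]]]]]] _;
  rewrite L2_lieE L2_bracket_coord /L2_minor !mxE !inord6E //=; ring.
Qed.

Lemma L2_ad_h_diagonal w k : (k < 6)%N ->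
  lie h w 0 (inord k) = [:: 2; -2; 0; 2; 0; -2]`_k * w 0 (inord k).
Proof.
by case: k => [|[|[|[|[|[|//]]]]]] _;
  rewrite L2_lieE L2_bracket_coord /L2_minor !mxE !inord6E //=; ring.
Qed.

(** On the eigenvalues 2, 0 and - 2 of ad h, adding 4 gives 6, 4 and 2. *)
Lemma L2_ad_h_no_eigenvalueN4 w :
  2 != 0 :> K -> 3 != 0 :> K -> lie h w = - 4 *: w -> w = 0.
Proof.
move=> two0 three0 eig; apply: L2_ext => k k6; rewrite [RHS]mxE.
have := congr1 (fun v : L2 K => v 0 (inord k)) eig.
rewrite [RHS]mxE L2_ad_h_diagonal // => /eqP; rewrite -subr_eq0 -mulrBl opprK.
rewrite mulf_eq0 => /orP[/eqP shifted0|/eqP //]; exfalso; move: shifted0.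
have [six four] : 2 + 4 = 2 * 3 :> K /\ 0 + 4 = 2 * 2 :> K by split; ring.
have two : -2 + 4 = 2 :> K by ring.
by case: k k6 => [|[|[|[|[|[|//]]]]]] _ /=; rewrite ?six ?four ?two => /eqP;
  rewrite ?mulf_eq0 ?(negPf two0) ?(negPf three0).
Qed.

(** The bracket with h isolates the weight-zero part, spanned by h and x_1, on
    which ad e is injective. *)
Lemma L2_centralizer_eh w :
  2 != 0 :> K -> lie e w = 0 -> lie h w = 0 -> w = 0.
Proof.
move=> two0 ew hw.
have cancel2 (y : K) : 2 * y = 0 -> y = 0.
  by move=> /eqP; rewrite mulf_eq0 (negPf two0) => /eqP.
have hwk k : (k < 6)%N -> [:: 2; -2; 0; 2; 0; -2]`_k * w 0 (inord k) = 0.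
  by move=> k6; rewrite -L2_ad_h_diagonal // hw mxE.
have ewk k : lie e w 0 (inord k) = 0 by rewrite ew mxE.
apply: L2_ext => k k6; rewrite [RHS]mxE; apply: cancel2.
case: k k6 => [|[|[|[|[|[|//]]]]]] k6.
- by rewrite -[RHS](hwk _ k6).
- by rewrite -[LHS]opprK -mulNr (hwk _ k6) oppr0.
- rewrite -[RHS]oppr0 -(ewk 0) L2_lieE L2_bracket_coord /L2_minor !mxE.
  by rewrite !inord6E //=; ring.
- by rewrite -[RHS](hwk _ k6).
- rewrite -[RHS]oppr0 -(ewk 3) L2_lieE L2_bracket_coord /L2_minor !mxE.
  by rewrite !inord6E //=; ring.
- by rewrite -[LHS]opprK -mulNr (hwk _ k6) oppr0.
Qed.

Lemma L2_half_derivation_eq0 (D : L2 K -> L2 K) :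
  2 != 0 :> K -> 3 != 0 :> K -> half_derivation D -> D e = 0 ->
  forall w, D w = 0.
Proof.
move=> two0 three0 halfD De0 w.
have [Dh0 Df0] : D h = 0 /\ D f = 0.
  apply: (half_derivation_sl2_triple_eq0 two0 halfD _ _ _ _ De0).
  - exact: L2_lie_ef.
  - exact: L2_lie_he.
  - exact: L2_lie_fh.
  - by move=> v; apply: L2_ad_h_no_eigenvalueN4.
apply: L2_centralizer_eh => //.
  have := half_derivation_commutator_centralizes w two0 halfD Dh0 De0.
  by rewrite L2_lie_he lieZl => /eqP; rewrite scaler_eq0 (negPf two0) => /eqP.
by rewrite -L2_lie_ef; apply: half_derivation_commutator_centralizes.
Qed.

Lemma L2_half_derivation_eq (D1 D2 : L2 K -> L2 K) :
  2 != 0 :> K -> 3 != 0 :> K -> half_derivation D1 -> half_derivation D2 ->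
  D1 e = D2 e -> D1 =1 D2.
Proof.
move=> two0 three0 half1 half2 eq_e w; apply/eqP; rewrite -subr_eq0; apply/eqP.
apply: (L2_half_derivation_eq0 two0 three0 (half_derivationB half1 half2)).
by rewrite eq_e subrr.
Qed.

End L2.

Theorem theorem23 (R : realType) (nabla : L2 R[i] -> L2 R[i]) :
  two_local_half_derivation nabla -> half_derivation nabla.
Proof.
move=> local2; have [D [halfD nabla_e _]] := local2 (L2_e _) (L2_e _).
have nablaE : nabla =1 D.
  move=> y; have [Dy [halfDy nabla_e' ->]] := local2 (L2_e _) y.
  apply: L2_half_derivation_eq halfDy halfD _ _; rewrite ?Num.Theory.pnatr_eq0 //.
  by rewrite -nabla_e -nabla_e'.
have [linD derD] := halfD.
by split=> [a x y|x y]; rewrite !nablaE ?linD ?derD.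
Qed.
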